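(* Let $p\ge 3$ be a prime. Let $g_2$ be an integer which is a non-zero square modulo $p$, let $s$ and $t_2$ be positive even integers with $t_2<s$, and let $f_2=p^{t_2}g_2$. As $f=f_2X^2+f_1X+f_0$ varies over the polynomials in $\mathbb{Z}[X]$ with this leading coefficient $f_2$ (with $f_1,f_0\in\mathbb{Z}$ arbitrary) that are not the square of a polynomial modulo $p^s$, the largest possible integer $N$ such that each of $f(1),\dots,f(N)$ is a square modulo $p^s$ is $$p^{\frac{s-t_2}{2}}-1$$ (that is, there are such sequences $(f(1),\dots,f(N))$ of this length, and no longer ones).
   Context: A polynomial $f\in\mathbb{Z}[X]$ is the square of a polynomial modulo $p^s$ if there is $\varphi\in\mathbb{Z}[X]$ (of any degree) such that $f$ and $\varphi^2$ have the same reduction in $(\mathbb{Z}/p^s\mathbb{Z})[X]$. The class of $0$ counts as a square. *)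

(* Defs.v *)
From mathcomp Require Import all_boot all_order all_algebra.

Set Implicit Arguments.
Unset Strict Implicit.
Unset Printing Implicit Defensive.

Import GRing.Theory.
Local Open Scope ring_scope.

Definition square_mod (m : nat) (a : int) : Prop :=
  exists b : int, (a = b ^+ 2 %[mod m])%Z.

(* 'Z_m is the ring Z/mZ only for 1 < m; this is used with m = p ^ s, where
   p is prime and 0 < s. *)
Definition reduce_poly (m : nat) (f : {poly int}) : {poly 'Z_m} :=
  map_poly (fun a : int => a%:~R) f.

Definition poly_square_mod (m : nat) (f : {poly int}) : Prop :=
  exists phi : {poly int}, reduce_poly m f = reduce_poly m (phi ^+ 2).

Definition quadratic (a2 a1 a0 : int) : {poly int} :=
  a2 *: 'X^2 + a1 *: 'X + a0%:P.

(* Some non-square polynomial modulo m with leading coefficient a2 takes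
   square values modulo m at 1, ..., N. *)
Definition nonsquare_run (m : nat) (a2 : int) (N : nat) : Prop :=
  exists a1 a0 : int,
    ~ poly_square_mod m (quadratic a2 a1 a0) /\
    forall n : nat, (1 <= n <= N)%N ->
      square_mod m (quadratic a2 a1 a0).[n%:Z].

Definition is_greatest (P : nat -> Prop) (N : nat) : Prop :=
  P N /\ forall M : nat, P M -> (M <= N)%N.

(* Main.v *)
Require Import Defs.
From mathcomp Require Import all_boot all_order all_algebra.
From mathcomp Require Import ring zify.
Import GRing.Theory.
Local Open Scope ring_scope.

(* The bound is attained by p^t2 g2 X^2 + p^(s-1): at n with v = v_p(n) < (s-t2)/2
   the first term has even valuation t2 + 2v < s - 1, so it dominates and Hensel's
   lemma applies, while the value p^(s-1) at 0 has odd valuation.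

   Conversely let f take square values at 1, ..., p^((s-t2)/2), and induct on t2.
   If t2 > 0, then p divides f1, as f1 X + f0 would otherwise represent a
   non-residue.  Either f0 is then a unit, and f, congruent mod p to a nonzero
   square constant, is a square by Hensel's lemma in Z[X]; or f is divisible by p^2,
   and f / p^2 is a smaller instance.  If t2 = 0, completing the square gives
   f = g2 (X + x)^2 + D, with D a square mod p^s because some n is -x mod p^(s/2).
   If D is p^(2k) c^2 with c a unit and 2k < s, taking n = -x + p^k j makes all
   g2 j^2 + c^2 squares mod p, which is impossible; so D = 0. *)

(** * Congruences as equations, and Hensel's lemma *)

Lemma PoszX (p k : nat) : (p ^ k)%N%:Z = p%:Z ^+ k.
Proof. by rewrite -!natz natrX. Qed.

(** An explicit multiple of the modulus turns goals about congruences into identities for [ring]. *)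
Lemma square_modP (m : nat) (a : int) :
  square_mod m a <-> exists b r : int, a = b ^+ 2 + m%:Z * r.
Proof.
split=> [[b /eqP]|[b [r ->]]].
  rewrite eqz_mod_dvd => /dvdzP[r abr]; exists b, r.
  by rewrite mulrC -abr; ring.
by exists b; rewrite addrC mulrC modzMDl.
Qed.

Lemma dvdz_primeM (p : nat) (a b : int) : prime p ->
  (p %| a * b)%Z = (p %| a)%Z || (p %| b)%Z.
Proof. by move=> p_pr; rewrite !dvdzE abszM Euclid_dvdM. Qed.

Lemma unit_mod_exp {p : nat} (k : nat) {a : int} : prime p -> ~~ (p %| a)%Z ->
  exists u v : int, a * u = 1 + p%:Z ^+ k * v.
Proof.
move=> p_pr pa; have [u [v uv]] := Bezoutz a (p ^ k)%N.
have /eqP g1 : coprimez a (p ^ k)%N.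
  by rewrite coprimezE /= coprimeXr // coprime_sym prime_coprime // -dvdzE.
by exists u, (- v); rewrite -PoszX -g1 -uv; ring.
Qed.

(** Newton iteration: [e] inverts [2d] modulo [P], so adding [P^(k+1) e r] to the root cancels the
    error [P^(k+1) r] modulo [P^(k+2)]. The ring is general so as to serve both Z and Z[X]. *)
Lemma hensel_sqrt {R : comRingType} {P d e l q : R} (k : nat) :
  2%:R * d * e = 1 + P * l ->
  exists w r : R, d ^+ 2 + P * q = (d + P * w) ^+ 2 + P ^+ k.+1 * r.
Proof.
move=> de; elim: k => [|k [w [r IH]]].
  by exists 0, q; rewrite expr1; ring.
pose r' := - (l * r) - 2%:R * w * e * r - P ^+ k * e ^+ 2 * r ^+ 2.
exists (w + P ^+ k * e * r), r'; rewrite {}IH.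
have -> : P ^+ k.+1 * r = P ^+ k.+1 * r * (2%:R * d * e - P * l).
  by rewrite de; ring.
by rewrite /r' !exprS; ring.
Qed.

(** * Vanishing modulo m, and a quadratic non-residue *)

Lemma int_eq0_Zp (m : nat) (z : int) : (1 < m)%N ->
  ((z%:~R : 'Z_m) == 0) = (m %| z)%Z.
Proof.
move=> m1; have nat_case n : ((n%:R : 'Z_m) == 0) = (m %| n)%N.
  by rewrite -val_eqE /= val_Zp_nat.
by case: z => n; rewrite ?NegzE ?rmorphN ?oppr_eq0 dvdzE ?abszN -nat_case.
Qed.

Lemma int_eq0_Fp (p : nat) (z : int) : prime p ->
  ((z%:~R : 'F_p) == 0) = (p %| z)%Z.
Proof.
by move=> p_pr; rewrite int_eq0_Zp pdiv_id ?prime_gt1.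
Qed.

(* Squaring on F_p identifies 1 and -1, hence is not onto. *)
Lemma exists_nonsquare {p : nat} : prime p -> (2 < p)%N ->
  ~ (forall y : nat, square_mod p y).
Proof.
move=> p_pr p3 allsq.
have sq_ex (x : 'F_p) : exists y : 'F_p, y ^+ 2 == x.
  have /square_modP[b [r br]] := allsq (nat_of_ord x).
  have p0 : (p%:Z%:~R : 'F_p) = 0 by apply/eqP; rewrite int_eq0_Fp.
  exists b%:~R; have -> : x = (x : nat)%:Z%:~R by rewrite -pmulrn natr_Zp.
  by rewrite br intrD intrM p0 mul0r addr0 rmorphXn.
pose sqrt (x : 'F_p) := xchoose (sq_ex x).
have sqrtK : cancel sqrt (fun y => y ^+ 2).
  by move=> x; apply/eqP/(xchooseP (sq_ex x)).
have /canF_sym/can_inj sq_inj := sqrtK.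
have /eqP : (1 : 'F_p) = -1 by apply: sq_inj; rewrite /= sqrrN.
rewrite -subr_eq0 opprK -[1 + 1]/(2%:Z%:~R) int_eq0_Fp // dvdzE /=.
by rewrite gtnNdvd.
Qed.

(** * Squares modulo powers of p, and valuations *)

Lemma square_mod_congr {m : nat} {a b : int} (k : int) :
  a = b + m%:Z * k -> square_mod m a -> square_mod m b.
Proof.
move=> ab /square_modP[c [r ac]]; apply/square_modP; exists c, (r - k).
by rewrite mulrBr addrA -ac ab addrK.
Qed.

Lemma square_mod_dvdn {m n : nat} {a : int} :
  (m %| n)%N -> square_mod n a -> square_mod m a.
Proof.
case/dvdnP=> k -> /square_modP[b [r ->]]; apply/square_modP.
by exists b, (k%:Z * r); rewrite PoszM; ring.
Qed.

(** A root of a multiple of p is itself a multiple of p, so p^2 cancels throughout, k times. *)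
Lemma square_mod_sqrM {p s k : nat} {a : int} : prime p ->
  square_mod (p ^ (s + 2 * k)) (p%:Z ^+ (2 * k) * a) -> square_mod (p ^ s) a.
Proof.
move=> p_pr; have pn0 : p%:Z != 0 by rewrite eqz_nat -lt0n prime_gt0.
elim: k => [|k IH]; first by rewrite muln0 addn0 mul1r.
have -> : (2 * k.+1 = (2 * k).+2)%N by lia.
rewrite !addnS => /square_modP[b [r]]; rewrite PoszX !(exprS p%:Z) => eq_b.
have : (p %| b * b)%Z.
  apply/dvdzP.
  exists (p%:Z * p%:Z ^+ (2 * k) * a - p%:Z * p%:Z ^+ (s + 2 * k) * r).
  have -> : b * b = b ^+ 2 by ring.
  apply: (addIr (p%:Z * (p%:Z * p%:Z ^+ (s + 2 * k)) * r)).
  by rewrite -eq_b; ring.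
rewrite dvdz_primeM // orbb => /dvdzP[c bc]; apply/IH/square_modP.
exists c, r; apply: (mulfI pn0); apply: (mulfI pn0).
have -> : p%:Z * (p%:Z * (p%:Z ^+ (2 * k) * a)) =
  p%:Z * (p%:Z * p%:Z ^+ (2 * k)) * a by ring.
by rewrite eq_b bc PoszX; ring.
Qed.

Lemma square_mod_dvd_sqr {p s : nat} {a : int} : prime p -> (1 < s)%N ->
  square_mod (p ^ s) a -> (p %| a)%Z -> (p%:Z ^+ 2 %| a)%Z.
Proof.
move=> p_pr s1; case: s s1 => [|[|s]] // _.
case/square_modP=> b [r ->]; rewrite PoszX !(exprS p%:Z) => /dvdzP[q eq_q].
have : (p %| b * b)%Z.
  apply/dvdzP; exists (q - p%:Z * p%:Z ^+ s * r).
  by rewrite mulrBl -eq_q; ring.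
rewrite dvdz_primeM // orbb => /dvdzP[c ->].
by apply/dvdzP; exists (c ^+ 2 + p%:Z ^+ s * r); ring.
Qed.

Lemma square_mod_odd_exp {p : nat} (k : nat) : prime p ->
  ~ square_mod (p ^ (2 * k).+2) (p%:Z ^+ (2 * k).+1).
Proof.
move=> p_pr; rewrite exprSr -addn2 addnC => /(square_mod_sqrM p_pr) sq_p.
have := square_mod_dvd_sqr p_pr (isT : (1 < 2)%N) sq_p (dvdzz _).
by rewrite dvdzE abszX gtnNdvd ?prime_gt0 //= ltn_Pmulr ?prime_gt0 ?prime_gt1.
Qed.

(** The p-adic valuation truncated at [m], which also covers [b = 0]. *)
Lemma dvdz_exp_or_cofactor (p m : nat) (b : int) :
  (p%:Z ^+ m %| b)%Z \/
  exists k c, [/\ (k < m)%N, b = p%:Z ^+ k * c & ~~ (p %| c)%Z].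
Proof.
elim: m b => [|m IH] b; first by left; rewrite expr0 dvd1z.
have [/dvdzP[c ->]|pb] := boolP (p %| b)%Z; last first.
  by right; exists 0%N, b; rewrite mul1r.
case: (IH c) => [/dvdzP[d ->]|[k [d [km -> pd]]]].
  by left; apply/dvdzP; exists d; rewrite exprSr; ring.
by right; exists k.+1, d; split=> //; rewrite exprSr; ring.
Qed.

(** * Residue classes, non-residues as values, and lifting of unit squares *)

Lemma exists_residue {M : nat} (x : int) : (0 < M)%N ->
  exists (n : nat) (k : int), (1 <= n <= M)%N /\ n%:Z = x + M%:Z * k.
Proof.
move=> M0; have Mn0 : M%:Z != 0 by rewrite eqz_nat -lt0n.
have r0 := modz_ge0 (x - 1) Mn0; have rM := ltz_pmod (x - 1) (M0 : 0 < M%:Z).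
have xE := divz_eq (x - 1) M.
case: (modz _ _) r0 rM xE => // n _ nM xE.
by exists n.+1, (- ((x - 1) %/ M)%Z); split; [exact: nM | lia].
Qed.

Lemma linear_nonsquare {p : nat} {a : int} (b : int) :
  prime p -> (2 < p)%N -> ~~ (p %| a)%Z ->
  ~ (forall j : int, square_mod p (a * j + b)).
Proof.
move=> p_pr p3 pa sq; have [u [v uv]] := unit_mod_exp 1 p_pr pa.
apply: (exists_nonsquare p_pr p3) => y.
apply: (square_mod_congr (v * (y%:Z - b)) _ (sq (u * (y%:Z - b)))).
by rewrite mulrA uv; ring.
Qed.

(* Dividing by u^2, every c^2 j^2 + u^2 being a square makes the set of squares
   closed under successor. *)
Lemma sum_square_nonsquare {p : nat} {a u : int} :
  prime p -> (2 < p)%N -> ~~ (p %| a)%Z -> square_mod p a -> ~~ (p %| u)%Z ->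
  ~ (forall j : int, square_mod p (a * j ^+ 2 + u ^+ 2)).
Proof.
move=> p_pr p3 pa /square_modP[c [r ac]] pu sq.
have pc : ~~ (p %| c)%Z.
  apply: contra pa => /dvdzP[d cd]; apply/dvdzP; exists (d ^+ 2 * p + r).
  by rewrite ac cd; ring.
have [c' [cv]] := unit_mod_exp 1 p_pr pc; rewrite expr1 => cc'.
have [u' [uv]] := unit_mod_exp 1 p_pr pu; rewrite expr1 => uu'.
apply: (exists_nonsquare p_pr p3); elim=> [|y /square_modP[b [t yb]]].
  by apply/square_modP; exists 0, 0; ring.
(* With this j, [a j^2 + u^2 = u^2 (a c'^2 b^2 + 1)], which is u^2 (y + 1) modulo p. *)
have /square_modP[d [q eq_d]] := sq (u * b * c').
(* Error terms: [(u u')^2 = 1 + p U] and [a c'^2 = 1 + p C]. *)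
pose U := 2 * uv + p%:Z * uv ^+ 2.
pose C := 2 * cv + p%:Z * cv ^+ 2 + r * c' ^+ 2.
apply/square_modP; exists (u' * d).
exists (t - C * b ^+ 2 - U * ((1 + p%:Z * C) * b ^+ 2 + 1) + u' ^+ 2 * q).
have -> : (u' * d) ^+ 2 = u' ^+ 2 * (d ^+ 2 + p%:Z * q) - u' ^+ 2 * (p%:Z * q).
  by ring.
have -> : u' ^+ 2 * (d ^+ 2 + p%:Z * q) =
  (u * u') ^+ 2 * (((c * c') ^+ 2 + p%:Z * (r * c' ^+ 2)) * b ^+ 2 + 1).
  by rewrite -eq_d ac; ring.
by rewrite uu' cc' intS yb /U /C; ring.
Qed.

Lemma unit_square_lift {R : comRingType} {p : nat} (s : nat) {a : int} (q : R) :
  prime p -> (2 < p)%N -> ~~ (p %| a)%Z -> square_mod p a ->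
  exists phi r : R, a%:~R + p%:Z%:~R * q = phi ^+ 2 + p%:Z%:~R ^+ s * r.
Proof.
move=> p_pr p3 pa /square_modP[c [t ac]].
have p2c : ~~ (p %| 2 * c)%Z.
  rewrite dvdz_primeM // negb_or; apply/andP; split.
    by rewrite dvdzE gtnNdvd.
  apply: contra pa => /dvdzP[d cd]; apply/dvdzP; exists (d ^+ 2 * p + t).
  by rewrite ac cd; ring.
have [u [v]] := unit_mod_exp 1 p_pr p2c; rewrite expr1 => cu.
have cuR : 2%:R * c%:~R * u%:~R = 1 + p%:Z%:~R * v%:~R :> R.
  by rewrite -!intrM -[1]/(1%:~R) -intrD -cu; ring.
have [w [r eq_r]] := hensel_sqrt (q := t%:~R + q) s cuR.
exists (c%:~R + p%:Z%:~R * w), (p%:Z%:~R * r).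
by rewrite mulrA -exprSr -eq_r ac; ring.
Qed.

(** * Quadratics taking square values on a full run *)

Lemma unit_lead_run_square {p m : nat} {g f1 f0 : int} :
  prime p -> (2 < p)%N -> ~~ (p %| g)%Z -> square_mod p g ->
  (forall n : nat, (1 <= n <= p ^ m)%N ->
    square_mod (p ^ (2 * m)) (g * n%:Z ^+ 2 + f1 * n%:Z + f0)) ->
  exists phi r : {poly int},
    g%:~R * 'X^2 + f1%:~R * 'X + f0%:~R = phi ^+ 2 + p%:Z%:~R ^+ (2 * m) * r.
Proof.
move=> p_pr p3 pg sqg run.
have p2g : ~~ (p %| 2 * g)%Z.
  by rewrite dvdz_primeM // negb_or pg andbT dvdzE gtnNdvd.
have [e [l eg]] := unit_mod_exp (2 * m) p_pr p2g.
(* Here x is f1 / (2g) modulo p^(2m), and y absorbs the error. *)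
have [x [y f1E]] : exists x y, f1 = 2 * g * x - p%:Z ^+ (2 * m) * y.
  exists (e * f1), (l * f1); rewrite (mulrA (2 * g)) eg; ring.
have [D f0E] : exists D, f0 = g * x ^+ 2 + D by exists (f0 - g * x ^+ 2); ring.
have valE z : g * z ^+ 2 + f1 * z + f0 =
    g * (z + x) ^+ 2 + D - p%:Z ^+ (2 * m) * (y * z) by rewrite f1E f0E; ring.
have pm0 : (0 < p ^ m)%N by rewrite expn_gt0 prime_gt0.
have /square_modP[b [r0]] : square_mod (p ^ (2 * m)) D.
  have [n [k [/run sqn nE]]] := exists_residue (- x) pm0.
  rewrite valE in sqn.
  apply: (square_mod_congr (g * k ^+ 2 - y * n%:Z) _ sqn).
  by rewrite nE !PoszX mulnC exprM; ring.
rewrite PoszX => DE.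
case: (dvdz_exp_or_cofactor p m b) => [/dvdzP[q bq]|[k [c [km bc pc]]]].
  (* D vanishes modulo p^(2m), and g = h^2 there, so h (X + x) is a root of f. *)
  have [h [r hr]] := unit_square_lift (2 * m) (0 : {poly int}) p_pr p3 pg sqg.
  rewrite mulr0 addr0 in hr.
  exists (h * ('X + x%:~R)).
  exists (r * ('X + x%:~R) ^+ 2 + (q ^+ 2 + r0)%:~R - y%:~R * 'X).
  transitivity (g%:~R * ('X + x%:~R) ^+ 2 + p%:Z%:~R ^+ (2 * m) *
      ((q ^+ 2 + r0)%:~R - y%:~R * 'X) : {poly int}); last by rewrite hr; ring.
  have {}DE : D = p%:Z ^+ (2 * m) * (q ^+ 2 + r0).
    by rewrite DE bq mulnC exprM; ring.
  rewrite f1E f0E DE !(intrD, intrM, mulrNz) !rmorphXn; ring.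
case: (sum_square_nonsquare p_pr p3 pg sqg pc) => j.
have [n [h [/run sqn nE]]] := exists_residue (p%:Z ^+ k * j - x) pm0.
have [i mE] : exists i, m = (i.+1 + k)%N by exists (m - k.+1)%N; lia.
(* This is f(n) / p^(2k), still a square modulo p^(2(m-k)); modulo p it is g j^2 + c^2. *)
pose v := g * (j + p%:Z ^+ i.+1 * h) ^+ 2 + c ^+ 2 +
  p%:Z ^+ (2 * i.+1) * (r0 - y * n%:Z).
have sqv : square_mod (p ^ (2 * i.+1)) v.
  apply: (square_mod_sqrM (k := k) p_pr); rewrite -mulnDr -mE.
  have <- : g * n%:Z ^+ 2 + f1 * n%:Z + f0 = p%:Z ^+ (2 * k) * v; last by [].
  rewrite valE DE bc /v nE PoszX mE mulnDr !exprD ![(2 * _)%N]mulnC !exprM.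
  ring.
apply: (square_mod_congr (g * (2 * j * p%:Z ^+ i * h + p%:Z * (p%:Z ^+ i * h) ^+ 2)
  + p%:Z ^+ (2 * i).+1 * (r0 - y * n%:Z)) _ (square_mod_dvdn _ sqv)).
  have iE : (2 * i.+1 = (2 * i).+2)%N by lia.
  rewrite /v iE !exprS.
  ring.
by rewrite dvdn_exp.
Qed.

(** The run length depends only on s - t2 = 2(m + 1), so it survives division of f by p^2. The
    exponent [m.+1] makes the run meet every class modulo p. *)
Lemma run_square {p m t : nat} {g f1 f0 : int} :
  prime p -> (2 < p)%N -> ~~ (p %| g)%Z -> square_mod p g ->
  (forall n : nat, (1 <= n <= p ^ m.+1)%N -> square_mod (p ^ (2 * (m.+1 + t)))
    (p%:Z ^+ (2 * t) * g * n%:Z ^+ 2 + f1 * n%:Z + f0)) ->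
  exists phi r : {poly int},
    (p%:Z ^+ (2 * t) * g)%:~R * 'X^2 + f1%:~R * 'X + f0%:~R =
    phi ^+ 2 + p%:Z%:~R ^+ (2 * (m.+1 + t)) * r.
Proof.
move=> p_pr p3 pg sqg; elim: t f1 f0 => [|t IH] f1 f0.
  by rewrite muln0 mul1r addn0; exact: unit_lead_run_square.
have tE : (2 * t.+1 = (2 * t).+2)%N by lia.
have -> : (2 * (m.+1 + t.+1) = 2 * (m.+1 + t) + 2 * 1)%N by lia.
rewrite tE => run.
have pm0 : (0 < p ^ m.+1)%N by rewrite expn_gt0 prime_gt0.
have sq_p n : (1 <= n <= p ^ m.+1)%N -> square_mod p (f1 * n%:Z + f0).
  move/run=> sqn; apply: (square_mod_congr (p%:Z ^+ (2 * t).+1 * g * n%:Z ^+ 2)).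
    2: by apply: square_mod_dvdn sqn; rewrite addnC dvdn_exp.
  by rewrite !exprS; ring.
have /dvdzP[F1 f1E] : (p %| f1)%Z.
  have [//|pf1] := boolP (p %| f1)%Z.
  case: (linear_nonsquare f0 p_pr p3 pf1) => j.
  have [n [k [/sq_p sqn nE]]] := exists_residue j pm0.
  apply: (square_mod_congr (f1 * p%:Z ^+ m * k) _ sqn).
  by rewrite nE PoszX exprS; ring.
have [pf0|pf0] := boolP (p %| f0)%Z; last first.
  have sq0 : square_mod p f0.
    apply: (square_mod_congr F1 _ (sq_p 1%N _)); last by rewrite pm0.
    by rewrite f1E; ring.
  (* Lifting in Z[X]: f = f0 + p q, where q collects the non-constant terms divided by p. *)
  have [h [r hr]] := unit_square_lift (2 * (m.+1 + t) + 2 * 1)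
    ((p%:Z ^+ (2 * t).+1 * g)%:~R * 'X^2 + F1%:~R * 'X : {poly int}) p_pr p3 pf0 sq0.
  by exists h, r; rewrite -hr f1E !exprS; ring.
have sqr_dvd n : (1 <= n <= p ^ m.+1)%N -> (p%:Z ^+ 2 %| f1 * n%:Z + f0)%Z.
  move/run; set z := p%:Z ^+ (2 * t) * g * n%:Z ^+ 2.
  have -> : p%:Z ^+ (2 * t).+2 * g * n%:Z ^+ 2 + f1 * n%:Z + f0 =
      z * p%:Z ^+ 2 + (f1 * n%:Z + f0) by rewrite /z !exprS; ring.
  have pn : (p %| f1 * n%:Z + f0)%Z.
    by rewrite rpredD // f1E mulrAC dvdz_mull.
  have p2z : (p%:Z ^+ 2 %| z * p%:Z ^+ 2)%Z by rewrite dvdz_mull.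
  have pz : (p %| z * p%:Z ^+ 2)%Z by rewrite expr2 mulrA dvdz_mull.
  move=> /(square_mod_dvd_sqr p_pr); rewrite addnS ltnS addn1 /= => /(_ isT).
  by rewrite (rpredDl _ p2z) (rpredDl _ pz) => /(_ pn).
have le2 : (2 <= p ^ m.+1)%N.
  by rewrite expnS (leq_trans (prime_gt1 p_pr)) // leq_pmulr // expn_gt0 prime_gt0.
(* The values of f1 X + f0 at 1 and 2 determine f1 and f0, so p^2 divides both. *)
have d1 := sqr_dvd 1%N (ltnW le2); have d2 := sqr_dvd 2%N le2.
have /dvdzP[H1 H1E] : (p%:Z ^+ 2 %| f1)%Z.
  have -> : f1 = f1 * 2%:Z + f0 - (f1 * 1%:Z + f0) by ring.
  exact: rpredB.
have /dvdzP[H0 H0E] : (p%:Z ^+ 2 %| f0)%Z.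
  by move: d1; rewrite H1E mulr1 rpredDl // dvdz_mull.
have [|h [r hr]] := IH H1 H0.
  move=> n /run sqn; apply: (square_mod_sqrM (k := 1) p_pr).
  suff -> : p%:Z ^+ (2 * 1) * (p%:Z ^+ (2 * t) * g * n%:Z ^+ 2 + H1 * n%:Z + H0) =
    p%:Z ^+ (2 * t).+2 * g * n%:Z ^+ 2 + f1 * n%:Z + f0 by [].
  by rewrite H1E H0E !exprS; ring.
exists (p%:Z%:~R * h), r.
transitivity (p%:Z%:~R ^+ 2 * ((p%:Z ^+ (2 * t) * g)%:~R * 'X^2 +
  H1%:~R * 'X + H0%:~R) : {poly int}); last by rewrite hr exprD; ring.
by rewrite H1E H0E !exprS; ring.
Qed.

(** * From identities in Z[X] to the stated notions, and the theorem *)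

Lemma quadraticE (a2 a1 a0 : int) :
  quadratic a2 a1 a0 = a2%:~R * 'X^2 + a1%:~R * 'X + a0%:~R.
Proof.
have CE a : a%:P = a%:~R :> {poly int} by rewrite -[a in LHS]intz rmorph_int.
by rewrite /quadratic -!mul_polyC !CE.
Qed.

Lemma horner_quadratic (a2 a1 a0 x : int) :
  (quadratic a2 a1 a0).[x] = a2 * x ^+ 2 + a1 * x + a0.
Proof. by rewrite /quadratic !hornerE. Qed.

Lemma poly_square_mod_congr (m : nat) (phi r : {poly int}) :
  (1 < m)%N -> poly_square_mod m (phi ^+ 2 + m%:Z%:~R * r).
Proof.
move=> m1; exists phi; apply/polyP=> i; rewrite !coef_map coefD /=.
have -> : (m%:Z%:~R * r)`_i = m%:Z * r`_i by rewrite mulrzl coefMrz -mulrzl intz.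
suff m0 : (m%:Z%:~R : 'Z_m) = 0 by rewrite intrD intrM m0 mul0r addr0.
by apply/eqP; rewrite int_eq0_Zp // dvdzz.
Qed.

(** The constant coefficient of phi^2 is the square of that of phi; this certifies the extremal
    example as a non-square. *)
Lemma poly_square_mod_coef0 {m : nat} {f : {poly int}} :
  (1 < m)%N -> poly_square_mod m f -> square_mod m f`_0.
Proof.
move=> m1 [phi /polyP/(_ 0%N)]; rewrite !coef_map /= expr2 coef0M => /eqP.
rewrite -subr_eq0 -intrB int_eq0_Zp // => /dvdzP[r eq_r].
apply/square_modP; exists phi`_0, r.
by rewrite [m%:Z * r]mulrC -eq_r; ring.
Qed.

Theorem theorem1p2 (p : nat) (g2 : int) (s t2 : nat)
    (p_prime : prime p) (p_ge3 : (3 <= p)%N)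
    (g2_square : square_mod p g2) (g2_nonzero : ~ (g2 = 0 %[mod p])%Z)
    (s_gt0 : (0 < s)%N) (s_even : ~~ odd s)
    (t2_gt0 : (0 < t2)%N) (t2_even : ~~ odd t2) (t2_lt_s : (t2 < s)%N) :
  is_greatest (nonsquare_run (p ^ s) ((p ^ t2)%N%:Z * g2))
    (p ^ ((s - t2) %/ 2) - 1).
Proof.
have pg : ~~ (p %| g2)%Z.
  by apply/negP => pg; apply/g2_nonzero/eqP; rewrite eqz_mod_dvd subr0.
have [t tE] : exists t, t2 = (2 * t)%N by exists t2./2; lia.
have [m sE] : exists m, s = (2 * (m.+1 + t))%N by exists (s./2 - t).-1; lia.
have -> : ((s - t2) %/ 2 = m.+1)%N by lia.
have m1 : (1 < p ^ s)%N by rewrite -{1}(exp1n s) ltn_exp2r // prime_gt1.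
split; last first.
  (* A longer run would contain 1, ..., p^(m+1), forcing f to be a square. *)
  move=> M [f1 [f0 [nonsq run]]]; rewrite leqNgt; apply/negP => M_large.
  have [n nM|h [r hr]] := run_square (f1 := f1) (f0 := f0) (m := m) (t := t)
      p_prime p_ge3 pg g2_square.
    have := run n; rewrite horner_quadratic PoszX tE sE; apply.
    by move: nM M_large; lia.
  apply: nonsq; rewrite quadraticE PoszX tE hr -sE -rmorphXn -PoszX.
  exact: poly_square_mod_congr.
exists 0, (p%:Z ^+ s.-1); split=> [/(poly_square_mod_coef0 m1)|n n_range].
  have -> : (s = (2 * (m + t)).+2)%N by lia.
  rewrite /quadratic !(coefE, coefD, coefZ) /= !mulr0 !add0r.
  exact: square_mod_odd_exp.
rewrite horner_quadratic mul0r addr0.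
(* As 0 < n < p^(m+1), the valuation k of n is at most m. *)
have [pn|[k [c [km nE pc]]]] := dvdz_exp_or_cofactor p m.+1 n%:Z.
  case/andP: n_range => n0 /leq_ltn_trans nlt.
  have := dvdn_leq n0; rewrite dvdzE abszX /= in pn; move/(_ _ pn).
  by rewrite leqNgt nlt // subn1 prednK // expn_gt0 prime_gt0.
have [i mE] : exists i, m = (k + i)%N by exists (m - k)%N; lia.
have pgc : ~~ (p %| g2 * c ^+ 2)%Z.
  by rewrite expr2 !dvdz_primeM // !negb_or pg pc.
have sqgc : square_mod p (g2 * c ^+ 2).
  have /square_modP[b [q ->]] := g2_square; apply/square_modP.
  by exists (b * c), (q * c ^+ 2); ring.
(* Since s - 1 = 2(t + k) + 2i + 1, f(n) is p^(2(t+k)) times the unit g2 c^2 + p p^(2i), whose root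
   is lifted here. *)
have [h [r hr]] :=
  unit_square_lift s (p%:Z ^+ (2 * i)) p_prime p_ge3 pgc sqgc.
apply/square_modP; exists (p%:Z ^+ (t + k) * h), (p%:Z ^+ (2 * (t + k)) * r).
rewrite !intz in hr.
have -> : s.-1 = (2 * (t + k) + (2 * i).+1)%N by clear -sE mE; lia.
rewrite nE PoszX tE PoszX.
transitivity (p%:Z ^+ (2 * (t + k)) * (g2 * c ^+ 2 + p%:Z * p%:Z ^+ (2 * i))).
  have pE : p%:Z ^+ (2 * (t + k)) = p%:Z ^+ (2 * t) * (p%:Z ^+ k) ^+ 2.
    by rewrite mulnDr exprD [(2 * k)%N]mulnC (exprM _ k).
  by rewrite (exprD _ (2 * (t + k))) (exprS p%:Z) pE; ring.
by rewrite hr mulnC exprM; ring.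
Qed.
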